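(* For every positive integer $n$, $$\sum_{\ell(\lambda)\le n}\binom{n}{m_0(\lambda),m_1(\lambda),\dots}\prod_{i=1}^n q_i^{\lambda_i}=\frac{\sum_{\pi\in S_n}\prod_{i=1}^n q_i^{d_i(\pi)}}{\prod_{i=1}^n(1-q_1\cdots q_i)}$$ in $\mathbf{Z}[[q_1,\dots,q_n]]$, where the sum on the left is over all partitions $\lambda=(\lambda_1,\dots,\lambda_n)$ with at most $n$ nonzero parts.
   Context: For a partition $\lambda=(\lambda_1\ge\dots\ge\lambda_n\ge0)$, $m_j(\lambda)=|\{1\le i\le n:\lambda_i=j\}|$ for $j\ge0$, and the coefficient is the multinomial coefficient. For $\pi\in S_n$, ${\it Des}(\pi)=\{i\in[n-1]:\pi(i)>\pi(i+1)\}$ and $d_i(\pi)=|\{j\in{\it Des}(\pi):j\ge i\}|$. *)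

(* Defs.v *)
From HB Require Import structures.
From mathcomp Require Import all_boot all_order all_fingroup all_algebra.
From mathcomp Require Import finmap boolp.
From mathcomp.multinomials Require Import mpoly.

Set Implicit Arguments.
Unset Strict Implicit.
Unset Printing Implicit Defensive.

Import GRing.Theory.
Local Open Scope ring_scope.

Record mfps (n : nat) (R : Type) := MFps { mfcoeff : 'X_{1..n} -> R }.

Notation "{ 'mfps' R [ n ] }" := (mfps n R)
  (at level 0, R at level 2, n at level 2, format "{ 'mfps'  R [ n ] }")
  : type_scope.

HB.instance Definition _ (n : nat) (R : Type) := gen_eqMixin {mfps R[n]}.
HB.instance Definition _ (n : nat) (R : Type) := gen_choiceMixin {mfps R[n]}.

Lemma mfpsP (n : nat) (R : Type) (f g : {mfps R[n]}) :
  (forall m, mfcoeff f m = mfcoeff g m) -> f = g.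
Proof. by case: f g => [f] [g] /= fg; congr MFps; apply/funext. Qed.

Section Ring.
Variables (n : nat) (R : comNzRingType).
Implicit Types (f g h : {mfps R[n]}) (m : 'X_{1..n}).

Definition mfps_zero : {mfps R[n]} := MFps (fun _ => 0).
Definition mfps_opp f : {mfps R[n]} := MFps (fun m => - mfcoeff f m).
Definition mfps_add f g : {mfps R[n]} :=
  MFps (fun m => mfcoeff f m + mfcoeff g m).

Fact mfps_addA : associative mfps_add.
Proof. by move=> f g h; apply: mfpsP => m /=; rewrite addrA. Qed.
Fact mfps_addC : commutative mfps_add.
Proof. by move=> f g; apply: mfpsP => m /=; rewrite addrC. Qed.
Fact mfps_add0 : left_id mfps_zero mfps_add.
Proof. by move=> f; apply: mfpsP => m /=; rewrite add0r. Qed.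
Fact mfps_addN : left_inverse mfps_zero mfps_opp mfps_add.
Proof. by move=> f; apply: mfpsP => m /=; rewrite addNr. Qed.

HB.instance Definition _ := GRing.isZmodule.Build {mfps R[n]}
  mfps_addA mfps_addC mfps_add0 mfps_addN.

Definition mfps_one : {mfps R[n]} := MFps (fun m => (m == 0%MM)%:R).

(* The Cauchy product; the degree bounds only make the index type finite. *)
Definition mfps_mul f g : {mfps R[n]} := MFps (fun m =>
  \sum_(k : 'X_{1..n < (mdeg m).+1, (mdeg m).+1} | m == (k.1 + k.2)%MM)
     mfcoeff f k.1 * mfcoeff g k.2).

(* The ring axioms are inherited from {mpoly R[n]} by truncation. *)
Let trunc d f : {mpoly R[n]} :=
  \sum_(m : 'X_{1..n < d}) mfcoeff f m *: 'X_[m].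

Let truncE d f m : (mdeg m < d)%N -> (trunc d f)@_m = mfcoeff f m.
Proof. by move=> md; rewrite /trunc (mcoeff_mpoly (mfcoeff f) md). Qed.

Let mulE_coef f g (p q : {mpoly R[n]}) m :
  (forall k, (mdeg k <= mdeg m)%N -> mfcoeff f k = p@_k) ->
  (forall k, (mdeg k <= mdeg m)%N -> mfcoeff g k = q@_k) ->
  mfcoeff (mfps_mul f g) m = (p * q)@_m.
Proof.
move=> fp gq; rewrite mcoeffM /=; apply: eq_bigr => -[[k1 h1] [k2 h2]] /= _.
by rewrite fp // gq.
Qed.

Let mul_truncE f g d m : (mdeg m < d)%N ->
  mfcoeff (mfps_mul f g) m = (trunc d f * trunc d g)@_m.
Proof.
by move=> md; apply: mulE_coef => k km; rewrite truncE //; apply: leq_ltn_trans md.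
Qed.

Fact mfps_mulA : associative mfps_mul.
Proof.
move=> f g h; apply: mfpsP => m; pose d := (mdeg m).+1.
rewrite (@mulE_coef _ _ (trunc d f) (trunc d g * trunc d h)); first last.
- by move=> k km; apply: mul_truncE.
- by move=> k km; rewrite truncE.
rewrite (@mulE_coef _ _ (trunc d f * trunc d g) (trunc d h)) ?mulrA //.
- by move=> k km; apply: mul_truncE.
- by move=> k km; rewrite truncE.
Qed.

Fact mfps_mulC : commutative mfps_mul.
Proof.
by move=> f g; apply: mfpsP => m; rewrite !(@mul_truncE _ _ (mdeg m).+1) // mulrC.
Qed.

Fact mfps_mul1 : left_id mfps_one mfps_mul.
Proof.
move=> f; apply: mfpsP => m.
rewrite (@mulE_coef _ _ 1 (trunc (mdeg m).+1 f)) ?mul1r ?truncE // => k km.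
  by rewrite mcoeff1.
by rewrite truncE.
Qed.

Fact mfps_mulDl : left_distributive mfps_mul mfps_add.
Proof.
move=> f g h; apply: mfpsP => m /=; rewrite -big_split /=.
by apply: eq_bigr => k _; rewrite mulrDl.
Qed.

Fact mfps_one_neq0 : mfps_one != 0.
Proof.
apply/eqP => /(congr1 (fun f => mfcoeff f 0%MM)) /= /eqP.
by rewrite eqxx oner_eq0.
Qed.

HB.instance Definition _ := GRing.Zmodule_isComNzRing.Build {mfps R[n]}
  mfps_mulA mfps_mulC mfps_mul1 mfps_mulDl mfps_one_neq0.

Definition mfps_unit : pred {mfps R[n]} := fun f => `[< exists g, g * f = 1 >].
Definition mfps_inv f : {mfps R[n]} :=
  if pselect (exists g, g * f = 1) is left fu then projT1 (cid fu) else f.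

Fact mfps_mulVr : {in mfps_unit, left_inverse 1 mfps_inv *%R}.
Proof.
move=> f; rewrite unfold_in => /asboolP fu; rewrite /mfps_inv.
by case: pselect => // fu'; case: cid.
Qed.
Fact mfps_unitP f g : g * f = 1 -> mfps_unit f.
Proof. by move=> gf; apply/asboolP; exists g. Qed.
Fact mfps_inv_out : {in [predC mfps_unit], mfps_inv =1 id}.
Proof.
move=> f; rewrite inE unfold_in => /asboolPn fN; rewrite /mfps_inv.
by case: pselect.
Qed.

HB.instance Definition _ := GRing.ComNzRing_hasMulInverse.Build {mfps R[n]}
  mfps_mulVr mfps_unitP mfps_inv_out.

Definition mfpsX (i : 'I_n) : {mfps R[n]} := MFps (fun m => (m == U_(i)%MM)%:R).

(* The family F is summable with sum S, i.e. the net of its finite partial     *)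
(* sums converges to S coefficientwise, each coefficient being eventually     *)
(* constant.                                                                  *)
Definition mfps_has_sum (I : choiceType) (F : I -> {mfps R[n]})
    (S : {mfps R[n]}) : Prop :=
  forall m, exists J0 : {fset I}, forall J : {fset I}, (J0 `<=` J)%fset ->
    mfcoeff (\sum_(i <- J) F i) m = mfcoeff S m.

Lemma mfps_has_sum_unique (I : choiceType) (F : I -> {mfps R[n]}) S S' :
  mfps_has_sum F S -> mfps_has_sum F S' -> S = S'.
Proof.
move=> FS FS'; apply: mfpsP => m.
have [[J0 J0P] [J1 J1P]] := (FS m, FS' m).
by rewrite -(J0P (J0 `|` J1)%fset) ?fsubsetUl // (J1P _ (fsubsetUr _ _)).
Qed.

Let mul_congr f f' g m :
  (forall k, (mdeg k <= mdeg m)%N -> mfcoeff f k = mfcoeff f' k) ->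
  mfcoeff (f * g) m = mfcoeff (f' * g) m.
Proof.
by move=> ff'; apply: eq_bigr => -[[k1 h1] k2] /= _; rewrite ff' // -ltnS.
Qed.

Let mfcoeff_is_additive m : {morph (@mfcoeff n R)^~ m : f g / f - g}.
Proof. by []. Qed.

Lemma mfcoeffM0 f g :
  mfcoeff (f * g) 0%MM = mfcoeff f 0%MM * mfcoeff g 0%MM.
Proof. by rewrite (@mul_truncE f g 1) ?mdeg0 // rmorphM /= !truncE ?mdeg0. Qed.

Lemma mfcoeffX_low f k m :
  mfcoeff f 0%MM = 0 -> (mdeg m < k)%N -> mfcoeff (f ^+ k) m = 0.
Proof.
move=> f0; elim: k m => // k IHk m mk; rewrite exprS.
apply: big1 => -[[k1 h1] [k2 h2]] /= /eqP mE.
have [->|k1N0] := eqVneq k1 0%MM; first by rewrite f0 mul0r.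
rewrite IHk ?mulr0 //.
move: mk; rewrite mE mdegD ltnS; apply: leq_trans.
by rewrite -[X in (X < _)%N]add0n ltn_add2r lt0n mdeg_eq0.
Qed.

(* Division by a series with constant coefficient 1 is genuine: the inverse   *)
(* is given by the geometric series.                                          *)
Lemma mfps_unit1 f : mfcoeff f 0%MM = 1 -> f \is a GRing.unit.
Proof.
move=> f1; pose u := 1 - f.
have u0 : mfcoeff u 0%MM = 0.
  by rewrite /u mfcoeff_is_additive /= eqxx f1 subrr.
pose V d : {mfps R[n]} := \sum_(k < d) u ^+ k.
have VE d m : (mdeg m < d)%N -> mfcoeff (V d) m = mfcoeff (V (mdeg m).+1) m.
  elim: d => // d IHd; rewrite ltnS leq_eqVlt => /predU1P[-> //|md].
  by rewrite /V big_ord_recr /= mfcoeffX_low // addr0; apply: IHd.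
pose v : {mfps R[n]} := MFps (fun m => mfcoeff (V (mdeg m).+1) m).
suff vf : v * f = 1 by apply: mfps_unitP vf.
apply: mfpsP => m; rewrite (@mul_congr v (V (mdeg m).+1)) => [|k km]; last first.
  by rewrite [RHS]VE.
have -> : V (mdeg m).+1 * f = 1 - u ^+ (mdeg m).+1.
  rewrite -[f in LHS](subKr 1) -/u mulrC -opprB mulNr -subrX1 opprB //.
by rewrite mfcoeff_is_additive mfcoeffX_low // subr0.
Qed.

End Ring.

Notation "''q_' i" := (mfpsX _ i) (at level 8, i at level 2, format "''q_' i").

(* Partitions with at most n nonzero parts, padded with zeros to length n.    *)
Definition npart (n : nat) := {lam : n.-tuple nat | sorted geq lam}.
HB.instance Definition _ (n : nat) := Choice.on (npart n).

Definition part (n : nat) (lam : npart n) (i : 'I_n) : nat := tnth (val lam) i.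

Definition mult (n : nat) (lam : npart n) (j : nat) : nat :=
  #|[set i : 'I_n | part lam i == j]|.

(* Values j larger than every part have multiplicity 0 and contribute 0! = 1, *)
(* so the product may stop at the largest part.                               *)
Definition mult_coef (n : nat) (lam : npart n) : nat :=
  (n`! %/ \prod_(0 <= j < (\max_(i < n) part lam i).+1) (mult lam j)`!)%N.

(* Positions are numbered from 0: i stands for the position i + 1, both here  *)
(* and in ndes.                                                               *)
Definition Des (n : nat) (s : 'S_n) : {set 'I_n} :=
  [set i : 'I_n | [exists j : 'I_n, (j == i.+1 :> nat) && (s j < s i)%N]].

Definition ndes (n : nat) (s : 'S_n) (i : 'I_n) : nat :=
  #|[set j in Des s | (i <= j)%N]|.

(* Main.v *)
(* If P_k denotes the series of all partitions with at most k nonzero parts,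
   removing one column of height k gives (1 - q_1...q_k) P_k = P_(k-1), so that
   the inverse of the denominator is P_n.  The coefficient of q^m in the right
   hand side is then the number of permutations s such that m - d(s) is a
   partition, that is, if m is a partition, of those which are increasing on
   every level set of m.  Composing such permutations with arbitrary ones of the
   level sets gives every permutation exactly once, so there are
   n! / (m_0! m_1! ...) of them. *)

Require Import Defs.
From HB Require Import structures.
From mathcomp Require Import all_boot all_order all_fingroup all_algebra.
From mathcomp Require Import finmap boolp.
From mathcomp.multinomials Require Import mpoly.
From mathcomp Require Import zify.

Set Implicit Arguments.
Unset Strict Implicit.
Unset Printing Implicit Defensive.

Import GRing.Theory.
Local Open Scope ring_scope.

Lemma ord_chain n (P : 'I_n -> 'I_n -> Prop) :
  (forall i j k, P i j -> P j k -> P i k) ->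
  (forall i j : 'I_n, j = i.+1 :> nat -> P i j) ->
  forall i j : 'I_n, (i < j)%N -> P i j.
Proof.
move=> Ptr PS i [j +]; elim: j => // j IHj jn /=.
rewrite ltnS leq_eqVlt => /predU1P[ij|ij]; first by apply: PS; rewrite ij.
by apply: Ptr (IHj (ltnW jn) ij) (PS _ _ _).
Qed.

(** * Permutations increasing on prescribed sets of positions *)

Definition increasing_on n (A : {set 'I_n}) (s : 'S_n) : bool :=
  [forall i in A, forall j in A, (i < j)%N ==> (s i < s j)%N].

Lemma increasing_onP n (A : {set 'I_n}) (s : 'S_n) :
  reflect {in A &, forall i j : 'I_n, (i < j)%N -> (s i < s j)%N}
          (increasing_on A s).
Proof.
apply: (iffP forall_inP) => [sA i j iA jA|sA i iA].
  by move/forall_inP: (sA i iA) => /(_ j jA)/implyP.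
by apply/forall_inP => j jA; apply/implyP; apply: sA.
Qed.

(** Strong induction on the point [x]: if all smaller points are fixed, [k^-1 x < x] would itself be
    fixed, and [x < k^-1 x] gives [k x < x], a fixed point, hence [k x = x] by injectivity. *)
Lemma perm_on_increasing1 n (A : {set 'I_n}) (k : 'S_n) :
  perm_on A k -> increasing_on A k -> k = 1%g.
Proof.
move=> kA /increasing_onP kinc; apply/permP => i; rewrite perm1.
case: i => i ni; have [m] := ubnP i; elim: m i ni => // m IHm i ni.
rewrite ltnS => im; set x := Ordinal ni.
have fixlt (y : 'I_n) : (y < i)%N -> k y = y.
  by case: y => y ny /= yi; apply: IHm; lia.
have [xA|xA] := boolP (x \in A); last exact: out_perm kA xA.
have kVA : perm_on A k^-1%g by apply: perm_onV.
set y := k^-1%g x.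
have ky : k y = x by rewrite permKV.
have yA : y \in A by rewrite (perm_closed _ kVA).
case: (ltngtP y x) => [yx|xy|/val_inj yx]; last by rewrite -{1}yx.
  by have := fixlt _ yx; rewrite ky => xy; move: yx; rewrite -xy ltnn.
have := kinc _ _ xA yA xy; rewrite ky => /fixlt /perm_inj kx.
by rewrite kx.
Qed.

(* The sorting permutation maximizes [\sum_i i * s (h i)]. *)
Lemma increasing_on_sort n (A : {set 'I_n}) (s : 'S_n) :
  exists2 h : 'S_n, perm_on A h & increasing_on A (h * s)%g.
Proof.
pose F (h : 'S_n) := (\sum_(i < n) i * (h * s)%g i)%N.
have [h hA hmax] := @arg_maxnP _ 1%g (fun h => perm_on A h) F (perm_on1 A).
exists h => //; apply/increasing_onP => i j iA jA ij; rewrite ltnNge.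
apply/negP => sij.
have inj_s : (h * s)%g i != (h * s)%g j.
  by apply/negP => /eqP/perm_inj ij'; rewrite ij' ltnn in ij.
(* Swapping the values at an inversion [i < j] of [t = h * s] changes the sum by
   [(j - i) * (t i - t j) > 0], against maximality. *)
have hA' : perm_on A (tperm i j * h)%g.
  apply: perm_onM hA; apply: subset_trans (tperm_on i j) _.
  by apply/subsetP => k; rewrite !inE => /pred2P[]->.
have := hmax _ hA'; rewrite /F -mulgA; set t := (h * s)%g in sij inj_s *.
have ji : j != i by apply/eqP => ji; rewrite ji ltnn in ij.
have split2 (G : 'I_n -> nat) :
    (\sum_k G k = G i + (G j + \sum_(k | (k != i) && (k != j)) G k))%N.
  by rewrite (bigD1 i) //= (bigD1 j).
have rest : (\sum_(k | (k != i) && (k != j)) k * (tperm i j * t)%g k =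
             \sum_(k | (k != i) && (k != j)) k * t k)%N.
  by apply: eq_bigr => k /andP[ki kj]; rewrite permM tpermD // eq_sym.
rewrite !split2 rest !(permM _ t) tpermL tpermR; apply/negP; rewrite -ltnNge.
have: nat_of_ord (t i) <> t j by move/val_inj/eqP; apply/negP.
nia.
Qed.

(* Each [s] in [S] is uniquely [h * s'] with [h] supported on [A] and [s']
   increasing on [A]; recall that [(h * s') i = s' (h i)]. *)
Lemma card_increasing_on n (A : {set 'I_n}) (S : {set 'S_n}) :
  (forall h s, perm_on A h -> s \in S -> (h * s)%g \in S) ->
  #|S| = (#|A| `! * #|[set s in S | increasing_on A s]|)%N.
Proof.
move=> SA; set T := [set s in S | _].
have <- : #|[set h | perm_on A h]| = #|A| `! by rewrite -card_perm cardsE.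
rewrite -cardsX.
rewrite -(@card_in_imset _ _ (fun x : 'S_n * 'S_n => (x.1 * x.2)%g)).
  congr #|pred_of_set _|; apply/setP => s; apply/idP/imsetP => [sS|[[h t]]].
    have [h hA hs] := increasing_on_sort A s.
    exists (h^-1, h * s)%g; last by rewrite mulKg.
    by rewrite !inE /= perm_onV // hs SA.
  by rewrite !inE /= => /and3P[hA tS _] ->; apply: SA.
move=> [h s] [h' s']; rewrite !inE /= => /and3P[hA _ /increasing_onP sinc].
move=> /and3P[hA' _ /increasing_onP sinc'] hs.
have hsk : (s' = (h'^-1 * h) * s)%g by rewrite -mulgA hs mulKg.
have kA : perm_on A (h'^-1 * h)%g by rewrite perm_onM // perm_onV.
(* The quotient preserves order on [A]: if it reversed a pair, [s] increasing would make [s']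
   reverse that pair too. *)
have k1 : (h'^-1 * h = 1)%g.
  apply: (perm_on_increasing1 kA); apply/increasing_onP => i j iA jA ij.
  move: (sinc' _ _ iA jA ij); rewrite hsk !(permM _ s).
  set k := (h'^-1 * h)%g in kA *; apply: contraLR; rewrite -!leqNgt leq_eqVlt.
  case/predU1P => [/val_inj/perm_inj -> //|kji].
  by apply/ltnW/sinc => //; rewrite perm_closed.
by congr (_, _); [apply/esym/eqP; rewrite eq_mulVg1 k1|rewrite hsk k1 mul1g].
Qed.

Definition level_increasing n (f : 'I_n -> nat) (k : nat) : {set 'S_n} :=
  [set s : 'S_n |
    [forall j : 'I_k, increasing_on [set i | f i == j :> nat] s]].

(** Induction on the number of constrained levels. A permutation supported on level [k] fixes the
    lower levels pointwise, so [card_increasing_on] applies and level [k] splits off its own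
    factorial. *)
Lemma card_level_increasing n (f : 'I_n -> nat) k :
  (#|level_increasing f k| * \prod_(0 <= j < k) #|[set i | f i == j]| `! = n`!)%N.
Proof.
elim: k => [|k IHk].
  rewrite big_geq // muln1 -card_Sn; apply: eq_card => s.
  by rewrite !inE; apply/forallP => -[].
rewrite big_nat_recr //= mulnA [(_ * _ * _`!)%N]mulnAC -{}IHk; congr (_ * _)%N.
rewrite mulnC (@card_increasing_on _ [set i | f i == k]) => [|h s hA].
  congr (_ * _)%N; apply: eq_card => s; rewrite !inE.
  apply/forallP/andP => [sk|[/forallP sk skk] [j jk]].
    split; last exact: (sk ord_max).
    by apply/forallP => j; apply: (sk (widen_ord (leqnSn k) j)).
  have /predU1P[jk'|jk'] : (j == k) || (j < k)%N by rewrite -leq_eqVlt.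
    by rewrite /= jk'.
  exact: (sk (Ordinal jk')).
rewrite !inE => /forallP sk; apply/forallP => j.
have hj i : f i = j -> h i = i.
  move=> fi; apply: out_perm hA _; rewrite inE fi.
  by have := ltn_ord j; case: eqP => // ->; rewrite ltnn.
apply/increasing_onP => a b; rewrite !inE => /eqP fa /eqP fb ab.
by rewrite !permM !hj //; move/increasing_onP: (sk j); apply; rewrite ?inE ?fa ?fb.
Qed.

(** * Descent numbers *)

Lemma ndesS n (s : 'S_n) (i j : 'I_n) :
  j = i.+1 :> nat -> ndes s i = (ndes s j + (s j < s i))%N.
Proof.
move=> ji; have iDes : (i \in Des s) = (s j < s i)%N.
  rewrite inE; apply/existsP/idP => [[k /andP[/eqP ki]]|sji].
    by have -> : k = j by apply: val_inj; rewrite /= ki ji.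
  by exists j; rewrite ji eqxx.
rewrite /ndes (cardsD1 i) inE iDes leqnn andbT addnC; congr (_ + _)%N.
apply: eq_card => k; rewrite !inE ji ltn_neqAle (eq_sym k) andbCA.
by rewrite -(inj_eq val_inj).
Qed.

Lemma ndes_last n (s : 'S_n) (i : 'I_n) : i.+1 = n -> ndes s i = 0%N.
Proof.
move=> ni; apply/eqP; rewrite cards_eq0; apply/eqP/setP => j; rewrite !inE.
apply/negP => /andP[/existsP[k /andP[/eqP kj _]] ij].
by have := ltn_ord k; rewrite kj; lia.
Qed.

(** Equal counts mean that no descent lies between, so [s] climbs at each step. The conjunction is
    transitive, so consecutive positions suffice. *)
Lemma ndes_increasing n (s : 'S_n) (i j : 'I_n) : (i < j)%N ->
  (ndes s j <= ndes s i)%N /\ (ndes s i = ndes s j -> (s i < s j)%N).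
Proof.
move: i j; apply: ord_chain => [i j k [ij sij] [jk sjk]|i j ji].
  by split; [lia | move=> ik; apply: ltn_trans (sij _) (sjk _); lia].
rewrite (ndesS s ji); split; first by lia.
have: nat_of_ord (s i) <> s j by move/val_inj/perm_inj => ij; rewrite ij in ji; lia.
by case: ltngtP => //; lia.
Qed.

(** * Monomials as power series *)

Section Series.
Variables (n : nat) (R : comNzRingType).
Implicit Types (f g : {mfps R[n]}) (m e : 'X_{1..n}).

Lemma mfcoeff_sum (I : Type) (r : seq I) (P : pred I) (F : I -> {mfps R[n]}) m :
  mfcoeff (\sum_(i <- r | P i) F i) m = \sum_(i <- r | P i) mfcoeff (F i) m.
Proof. exact: (big_morph (fun f => mfcoeff f m)). Qed.

Lemma mfcoeff_natl (c : nat) f m : mfcoeff (c%:R * f) m = c%:R * mfcoeff f m.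
Proof.
rewrite !mulr_natl; elim: c => // c IHc.
by rewrite !mulrS -{}IHc.
Qed.

Definition mfps_mono e : {mfps R[n]} := MFps (fun m => (m == e)%:R).

Lemma mfcoeff_monoM e f m :
  mfcoeff (mfps_mono e * f) m =
    if (e <= m)%MM then mfcoeff f (m - e)%MM else 0.
Proof.
rewrite /GRing.mul /=; case: ifP => [em|/negP em]; last first.
  apply: big1 => -[[k1 h1] [k2 h2]] /= /eqP mE.
  have [k1e|_] := eqVneq k1 e; last by rewrite mul0r.
  by case: em; apply/mnm_lepP => i; rewrite mE k1e mnmDE leq_addr.
have h1 : (mdeg e < (mdeg m).+1)%N by rewrite -(submK em) mdegD ltnS leq_addl.
have h2 : (mdeg (m - e)%MM < (mdeg m).+1)%N.
  by rewrite -{2}(submK em) mdegD ltnS leq_addr.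
rewrite (bigD1 (BMultinom h1, BMultinom h2)) /=; last by rewrite addmC submK.
rewrite eqxx mul1r big1 ?addr0 // => -[[k1 l1] [k2 l2]] /andP[/= /eqP mE].
have [k1e|_] := eqVneq k1 e; last by rewrite mul0r.
case/eqP; congr (_, _); apply/val_inj; rewrite /= ?k1e //.
by rewrite mE k1e addmC addmK.
Qed.

Lemma mfps_monoM : {morph mfps_mono : a b / (a + b)%MM >-> a * b}.
Proof.
move=> a b; apply: mfpsP => m; rewrite mfcoeff_monoM /=.
case: ifP => [am|/negP am].
  by congr (nat_of_bool _)%:R; apply/eqP/eqP => [->|<-];
    rewrite addmC ?addmK ?submK.
by case: eqP => // mE; case: am; apply/mnm_lepP => i; rewrite mE mnmDE leq_addr.
Qed.

(** The predicate lets one formula serve both the partial products in the denominator and the full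
    monomials of the sums. *)
Lemma prod_mfpsX (P : pred 'I_n) (a : 'I_n -> nat) :
  \prod_(i < n | P i) ('q_i : {mfps R[n]}) ^+ a i =
    mfps_mono [multinom (if P i then a i else 0)%N | i < n].
Proof.
have XE i k : ('q_i : {mfps R[n]}) ^+ k = mfps_mono (U_(i) *+ k)%MM.
  elim: k => [|k IHk]; first by rewrite mulm0n.
  by rewrite exprS IHk mulmS mfps_monoM.
rewrite (eq_bigr _ (fun i _ => XE i (a i))).
rewrite -(big_morph _ mfps_monoM (erefl _ : mfps_mono 0%MM = 1)).
congr mfps_mono; apply/mnmP => i; rewrite mnmE mnm_sumE big_mkcond (bigD1 i) //=.
rewrite mulmnE mnm1E eqxx mul1n big1 ?addn0 // => j ji.
by rewrite mulmnE mnm1E (negPf ji) mul0n if_same.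
Qed.

(** * Partitions as exponents and the inverse of the denominator *)

Definition decr m : bool :=
  [forall i : 'I_n, forall (j : 'I_n | (i <= j)%N), (m j <= m i)%N].

Lemma decrP m :
  reflect (forall i j : 'I_n, (i <= j)%N -> (m j <= m i)%N) (decr m).
Proof.
apply: (iffP forallP) => [dm i j|dm i]; first by move/forall_inP: (dm i); apply.
by apply/forall_inP => j; apply: dm.
Qed.

Lemma decr_sorted m : decr m = sorted geq m.
Proof.
have geq_tr : transitive geq by move=> a b c /= ba cb; apply: leq_trans ba.
rewrite sorted_pairwise //; apply/decrP/(pairwiseP 0%N) => [dm i j|pm i j].
  rewrite !inE size_tuple => ni nj ij.
  have := dm (Ordinal ni) (Ordinal nj) (ltnW ij).
  by rewrite !(mnm_nth 0%N).
rewrite leq_eqVlt => /predU1P[/val_inj->//|ij].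
rewrite !(mnm_nth 0%N); apply: pm => //; by rewrite inE size_tuple.
Qed.

Definition mfps_partitions (k : nat) : {mfps R[n]} :=
  MFps (fun m => (decr m && [forall (i : 'I_n | (k <= i)%N), m i == 0%N])%:R).

Lemma mfps_partitions0 : mfps_partitions 0 = 1.
Proof.
apply: mfpsP => m; congr (nat_of_bool _)%:R.
apply/andP/eqP => [[_ /forall_inP m0]|->].
  by apply/mnmP => i; rewrite mnm0E; apply/eqP/m0.
by split; [apply/decrP => i j _|apply/forall_inP => i _]; rewrite !mnm0E.
Qed.

(** Multiplying by the product adds 1 to the parts at positions [0..k]; this yields exactly the
    partitions with [k + 1] nonzero parts, and the difference keeps those with [m k = 0]. *)
Lemma mfps_partitionsS (k : 'I_n) :
  (1 - \prod_(j < n | (j <= k)%N) 'q_j) * mfps_partitions k.+1 =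
    mfps_partitions k.
Proof.
have -> : \prod_(j < n | (j <= k)%N) 'q_j =
    mfps_mono [multinom (if (j <= k)%N then 1 else 0)%N | j < n].
  have := prod_mfpsX (fun j : 'I_n => (j <= k)%N) (fun=> 1%N).
  by under eq_bigr do rewrite expr1.
set e := [multinom _ | _ < _]; apply: mfpsP => m.
have eE j : e j = (j <= k)%N by rewrite mnmE; case: leqP.
rewrite mulrBl mul1r; set S := mfps_partitions k.+1.
have -> : mfcoeff (S - mfps_mono e * S) m =
  mfcoeff S m - mfcoeff (mfps_mono e * S) m by [].
rewrite mfcoeff_monoM /=; have [mk0|mk0] := posnP (m k).
  have -> : (e <= m)%MM = false.
    by apply/negP => /mnm_lepP/(_ k); rewrite eE mk0 leqnn.
  rewrite subr0; congr (nat_of_bool (_ && _))%:R.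
  apply/forall_inP/forall_inP => m0 i; last by move/ltnW; apply: m0.
  by rewrite leq_eqVlt => /predU1P[/val_inj<-|]; [rewrite mk0|apply: m0].
(* For [m k > 0] the target coefficient is 0, so [m] and [m - e] must be counted alike. *)
have -> : (decr m && [forall (i : 'I_n | (k <= i)%N), m i == 0%N]) = false.
  by apply/negP => /andP[_ /forall_inP/(_ k (leqnn _))]; rewrite -leqn0 leqNgt mk0.
apply/eqP; rewrite subr_eq0; apply/eqP.
case: ifP => [/mnm_lepP em|/negP em]; last first.
  case: (boolP (decr m)) => // /decrP dm; case: em; apply/mnm_lepP => j.
  by rewrite eE; case: (leqP j k) => // jk; apply: (leq_trans mk0 (dm _ _ jk)).
congr (nat_of_bool _)%:R.
have supp : [forall (i : 'I_n | (k < i)%N), m i == 0%N] =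
            [forall (i : 'I_n | (k < i)%N), (m - e)%MM i == 0%N].
  apply: eq_forallb => i; rewrite mnmBE eE; case: ltnP => //=.
  by rewrite subn0.
rewrite -supp [LHS]andbC [RHS]andbC.
have [/forall_inP m0 /=|//] := boolP [forall (i : 'I_n | (k < i)%N), m i == 0%N].
have e0 (i : 'I_n) : (i <= k)%N = false -> m i = 0%N.
  by move/negbT; rewrite -ltnNge => /m0/eqP.
apply/decrP/decrP => dm i j ij; move: (dm i j ij) (em i) (em j) (e0 i) (e0 j);
  rewrite ?mnmBE !eE; case: (leqP i k); case: (leqP j k) => /=; lia.
Qed.

Lemma mfps_partitionsV :
  (\prod_(i < n) (1 - \prod_(j < n | (j <= i)%N) 'q_j))^-1 = mfps_partitions n.
Proof.
(* A product equal to 1 determines the inverse, so the default value of [^-1] at non-units does not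
   intervene. The product telescopes down to [mfps_partitions 0 = 1]. *)
apply: mulr1_eq.
suff IH k : (k <= n)%N ->
    (\prod_(i < n | (i < k)%N) (1 - \prod_(j < n | (j <= i)%N) 'q_j))
      * mfps_partitions k = 1.
  by rewrite -[RHS](IH n) //; congr (_ * _); apply: eq_bigl => i; rewrite ltn_ord.
elim: k => [|k IHk] kn.
  by rewrite big_pred0 // mul1r mfps_partitions0.
rewrite -[RHS]IHk ?(ltnW kn) // -(mfps_partitionsS (Ordinal kn)).
rewrite (bigD1 (Ordinal kn)) //= mulrCA mulrA; congr (_ * _ * _).
apply: eq_bigl => i; rewrite ltnS ltn_neqAle andbC; congr (_ && _).
Qed.

End Series.

(* [d_i - d_(i+1)] is 1 at the descents and 0 elsewhere, so [m - d(s)] is a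
   partition iff [m] is one and strictly decreases at each descent of [s]. *)
Lemma decr_sub_ndes n (m : 'X_{1..n}) (s : 'S_n) (e := [multinom ndes s i | i < n]) :
  ((e <= m)%MM && decr (m - e)%MM) =
  decr m && (s \in level_increasing m (\max_(i < n) m i).+1).
Proof.
(* The bound exceeds every [m i], so all level sets are constrained. *)
have lvlP : reflect (forall i j : 'I_n, (i < j)%N -> m i = m j -> (s i < s j)%N)
    (s \in level_increasing m (\max_(i < n) m i).+1).
  rewrite inE; apply: (iffP forallP) => [sm i j ij mij|sm k].
    have mi : (m i < (\max_(i < n) m i).+1)%N by rewrite ltnS leq_bigmax.
    by move/increasing_onP: (sm (Ordinal mi)); apply; rewrite ?inE /= -?mij ?eqxx.
  apply/increasing_onP => i j; rewrite !inE => /eqP mi /eqP mj ij.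
  by apply: sm; rewrite // mi mj.
apply/andP/andP => -[].
  move=> /mnm_lepP em /decrP dme.
  have dm (i j : 'I_n) : (i < j)%N -> (m j + ndes s i <= m i + ndes s j)%N.
    move=> ij; have := dme i j (ltnW ij); have := em i; have := em j.
    by rewrite !mnmBE !mnmE; lia.
  split.
    apply/decrP => i j; rewrite leq_eqVlt => /predU1P[/val_inj->//|ij].
    by have [] := ndes_increasing s ij; have := dm _ _ ij; lia.
  apply/lvlP => i j ij mij; have [dij] := ndes_increasing s ij; apply.
  by have := dm _ _ ij; lia.
move=> /decrP dm /lvlP sm.
(* Monotonicity of [m - e] stated without truncated subtraction. At a descent [sm] excludes equal
   parts, so [m] drops by at least 1. *)
have dme : forall i j : 'I_n, (i < j)%N -> (m j + ndes s i <= m i + ndes s j)%N.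
  apply: ord_chain => [i j k|i j ji]; first by lia.
  have ij : (i < j)%N by rewrite ji.
  rewrite (ndesS s ji); have := dm i j (ltnW ij); have := sm i j ij.
  by case: (ltnP (s j) (s i)); lia.
(* Comparison with the last position, where [ndes] is 0. *)
have em : (e <= m)%MM.
  apply/mnm_lepP => i; rewrite mnmE.
  have ni := ltn_ord i; have n1 : (n.-1 < n)%N by lia.
  have l0 : ndes s (Ordinal n1) = 0%N by apply: ndes_last => /=; lia.
  have [il|li] := ltnP i (Ordinal n1); first by have := dme _ _ il; lia.
  by rewrite (ndes_last s) //=; move: li => /=; lia.
split=> //; apply/decrP => i j; rewrite leq_eqVlt => /predU1P[/val_inj->//|ij].
have /mnm_lepP em' := em; move: (em' i) (em' j) (dme _ _ ij).
by rewrite !mnmBE !mnmE; lia.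
Qed.

(** The division in [mult_coef] is exact, since [card_level_increasing] factors [n!] through its
    divisor. *)
Lemma mult_coefE n (lam : npart n) :
  mult_coef lam =
    #|level_increasing (part lam) (\max_(i < n) part lam i).+1|.
Proof.
rewrite /mult_coef -(card_level_increasing (part lam) (\max_(i < n) part lam i).+1).
by rewrite mulnK // prodn_gt0 // => j; apply: fact_gt0.
Qed.

Theorem theorem6p2 (n : nat) (n_gt0 : (0 < n)%N) :
  mfps_has_sum
    (fun lam : npart n =>
       (mult_coef lam)%:R * \prod_(i < n) 'q_i ^+ part lam i : {mfps int[n]})
    ((\sum_(s : 'S_n) \prod_(i < n) 'q_i ^+ ndes s i)
       / (\prod_(i < n) (1 - \prod_(j < n | (j <= i)%N) 'q_j))).
Proof.
rewrite mfps_partitionsV; set S := _ * _.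
(* Each [s] contributes 1 exactly when [m] minus its descent vector is a partition. *)
have SE m : mfcoeff S m =
    if decr m then #|level_increasing m (\max_(i < n) m i).+1|%:R else 0.
  rewrite /S mulr_suml mfcoeff_sum.
  transitivity (\sum_(s : 'S_n)
      (decr m && (s \in level_increasing m (\max_(i < n) m i).+1))%:R : int).
    apply: eq_bigr => s _; rewrite prod_mfpsX mfcoeff_monoM -decr_sub_ndes.
    case: ifP => //= _; rewrite [X in _ && X](_ : _ = true) ?andbT //.
    by apply/forall_inP => i; rewrite leqNgt ltn_ord.
  case: (decr m); last exact: big1.
  rewrite -sum1_card natr_sum [RHS]big_mkcond /=.
  by apply: eq_bigr => s _; case: (_ \in _).
have FE (lam : npart n) m :
    mfcoeff ((mult_coef lam)%:R * \prod_(i < n) 'q_i ^+ part lam i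
              : {mfps int[n]}) m = (mult_coef lam * (m == Multinom (val lam)))%:R.
  rewrite mfcoeff_natl prod_mfpsX natrM; congr (_ * (_ == _)%:R).
  by apply/mnmP => i; rewrite mnmE multinomE.
move=> m; have [dm|Ndm] := boolP (decr m); last first.
  exists fset0 => J _; rewrite mfcoeff_sum SE (negPf Ndm).
  apply: big1 => lam _; rewrite FE; case: eqP => [mE|_]; last by rewrite muln0.
  by case/negP: Ndm; rewrite mE decr_sorted; apply: (valP lam).
have sm : sorted geq (multinom_val m) by rewrite -decr_sorted.
pose lam : npart n := exist _ (multinom_val m) sm.
(* Only the partition [lam] with exponent [m] contributes to this coefficient, so every finite set
   containing it already gives the limit value. *)
exists [fset lam]%fset => J; rewrite fsub1set => lamJ.
rewrite mfcoeff_sum SE dm (eq_bigr _ (fun mu _ => FE mu m)).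
rewrite (bigD1_seq lam) ?fset_uniq //= big1 => [|mu mu_lam].
  have -> : m == Multinom (val lam) by apply/eqP/val_inj.
  by rewrite addr0 muln1 mult_coefE.
case: eqP => [mE|_]; last by rewrite muln0.
by case/eqP: mu_lam; apply: val_inj; rewrite /= mE.
Qed.
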